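(* Let $(\mathcal{X},\rho,\nu)$ be a bounded length space with finite doubling dimension, equipped with a finite Borel measure $\nu$. Suppose the concept $c$ satisfies $\nu(\partial\mathcal{X})=0$, and let the adversary be $\sigma$-smooth for some $\sigma>0$. Let $d=d(\partial\mathcal{X})$ be the box-counting dimension and $\mathfrak{m}=\mathfrak{m}(\partial\mathcal{X})$ the (finite) Minkowski content of the boundary, and assume $d>1$. Then for any $c_1,c_2,p>0$ there exist constants $C_0,C_1>0$ such that with probability at least $1-p$ the 1-nearest neighbor rule satisfies, simultaneously for all $T\in\mathbb{N}$, $$\#\mathrm{mistakes}_T\le C_0+C_1\left(\frac{(\mathfrak{m}+c_2)T}{\sigma}\right)^{(d+c_1)/(d+1)}.$$
   Context: Length space: $\rho(x,x')$ equals the infimum of lengths of continuous paths from $x$ to $x'$. $\mathcal{N}_r(A)$ is the minimal number of radius-$r$ balls covering $A$. Doubling dimension $\Gamma$: there is $C>0$ with $\mathcal{N}_{r/2}(B(x,r))\le C2^\Gamma$ for all $r>0$, $x\in\mathcal{X}$; finite doubling dimension means some finite $\Gamma$ works. Box-counting dimension: $d(A)=\limsup_{r\to0}\log\mathcal{N}_r(A)/\log(1/r)$. $r$-expansion: $A^r=\bigcup_{x\in A}B(x,r)$. Minkowski content: $\mathfrak{m}(A)=\limsup_{r\to0}(\nu(A^r)-\nu(A))/r$. Margin $m_c(x)=\inf_{x':c(x')\ne c(x)}\rho(x,x')$, $\partial\mathcal{X}=\{x:m_c(x)=0\}$. Protocol: at each $t$ the adversary picks a distribution $\mu_t$ (possibly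 history-dependent), draws $x_t\sim\mu_t$; 1-nearest neighbor predicts $\hat y_t=c(x_{\mathrm{NN}_t})$, $\mathrm{NN}_t\in\arg\min_{\tau<t}\rho(x_t,x_\tau)$ (ties arbitrary); $\#\mathrm{mistakes}_T=\sum_{t\le T}\mathbb{1}\{\hat y_t\ne c(x_t)\}$. The adversary is $\sigma$-smooth if every distribution $\mu$ it selects satisfies $\mu(A)\le\nu(A)/\sigma$ for all measurable $A$. *)

(* Defs.v *)
From HB Require Import structures.
From mathcomp Require Import all_boot all_order all_algebra.
From mathcomp Require Import all_classical all_reals all_analysis.
Set Implicit Arguments. Unset Strict Implicit. Unset Printing Implicit Defensive.
Import Order.TTheory GRing.Theory Num.Theory.
Local Open Scope classical_set_scope.
Local Open Scope ring_scope.

Section Defs.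
Variables (R : realType) (X : Type) (rho : X -> X -> R).

Definition is_metric : Prop :=
  [/\ forall x, rho x x = 0,
      forall x y, rho x y = 0 -> x = y,
      forall x y, rho x y = rho y x &
      forall x y z, rho x z <= rho x y + rho y z].

Fixpoint inseq (y : X) (s : seq X) : Prop :=
  if s is z :: s' then z = y \/ inseq y s' else False.

Definition rball (x : X) (r : R) : set X := [set y | rho x y < r].

Definition rho_open (A : set X) : Prop :=
  forall x, A x -> exists2 r : R, 0 < r & rball x r `<=` A.

Definition bounded_space : Prop := exists B : R, forall x y, rho x y <= B.

Definition cont_path (g : R -> X) : Prop :=
  forall t, 0 <= t <= 1 -> forall e : R, 0 < e -> exists2 del : R, 0 < del &
    forall s, 0 <= s <= 1 -> `|s - t| < del -> rho (g s) (g t) < e.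

Definition partition_sum (g : R -> X) (s : seq R) : R :=
  \sum_(i < (size s).-1) rho (g (nth 0 s i)) (g (nth 0 s i.+1)).

Definition is_partition (s : seq R) : Prop :=
  sorted <=%R s /\ all (fun t => (0 <= t <= 1)) s.

Definition path_length (g : R -> X) : \bar R :=
  ereal_sup [set (partition_sum g s)%:E | s in is_partition].

Definition length_space : Prop :=
  forall x x', (rho x x')%:E =
    ereal_inf [set path_length g | g in
                 [set g | cont_path g /\ g 0 = x /\ g 1 = x']].

Definition finite_doubling_dim : Prop :=
  exists2 C : R, 0 < C & exists Gam : R, forall (r : R) (x : X), 0 < r ->
    exists s : seq X, ((size s)%:R <= C * (2 `^ Gam)) /\
      rball x r `<=` \bigcup_(y in [set y | inseq y s]) rball y (r / 2).

(* covering number N_r(A) (+oo if no finite cover) *)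
Definition covers (r : R) (A : set X) (n : nat) : Prop :=
  exists s : seq X, size s = n /\ A `<=` \bigcup_(y in [set y | inseq y s]) rball y r.

Definition covnum (r : R) (A : set X) : \bar R :=
  ereal_inf [set (n%:R)%:E | n in covers r A].

Definition elog (v : \bar R) : \bar R :=
  match v with
  | EFin a => (ln a)%:E
  | +oo%E => +oo%E
  | -oo%E => -oo%E
  end.

Definition limsup0 (f : R -> \bar R) : \bar R :=
  ereal_inf [set ereal_sup [set f r | r in [set r | 0 < r < del]]
            | del in [set del : R | 0 < del <= 1]].

Definition box_dim (A : set X) : \bar R :=
  limsup0 (fun r => (elog (covnum r A) * ((ln (1 / r))^-1)%:E)%E).

Definition expansion (A : set X) (r : R) : set X :=
  \bigcup_(x in A) rball x r.

Definition minkowski_content (nu : set X -> \bar R) (A : set X) : \bar R :=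
  limsup0 (fun r => ((fine (nu (expansion A r)) - fine (nu A)) / r)%:E).

Definition margin (Y : eqType) (c : X -> Y) (x : X) : \bar R :=
  ereal_inf [set (rho x x')%:E | x' in [set x' | c x' != c x]].

Definition cboundary (Y : eqType) (c : X -> Y) : set X :=
  [set x | margin c x = 0%E].

Definition is_nn (xs : nat -> X) (nn : nat -> nat) : Prop :=
  forall t, (0 < t)%N ->
    (nn t < t)%N /\ forall tau, (tau < t)%N -> rho (xs t) (xs (nn t)) <= rho (xs t) (xs tau).

(* mistakes in rounds 0..T-1; round 0 (no history) counts as a mistake *)
Definition mistakes (Y : eqType) (c : X -> Y) (xs : nat -> X) (nn : nat -> nat)
  (T : nat) : nat :=
  (\sum_(t < T) ((nat_of_ord t == 0%N) || (c (xs (nn t)) != c (xs t))))%N.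

End Defs.

Definition past_events (dO dX : measure_display) (O : measurableType dO)
  (X : measurableType dX) (xs : nat -> O -> X) (t : nat) : set (set O) :=
  <<s [set E | exists i A, (i < t)%N /\ measurable A /\ E = xs i @^-1` A] >>.

(* sigma-smooth adversary: the conditional law of x_t given the past is <= nu/sigma *)
Definition smooth_adversary (R : realType) (dO dX : measure_display)
  (O : measurableType dO) (X : measurableType dX) (P : probability O R)
  (nu : set X -> \bar R) (sigma : R) (xs : nat -> O -> X) : Prop :=
  forall t (A : set X) (E : set O), measurable A -> past_events xs t E ->
    (P (E `&` xs t @^-1` A) <= (sigma^-1)%:E * nu A * P E)%E.

(* Main.v *)
Require Import Defs.
From HB Require Import structures.
From mathcomp Require Import all_boot all_order all_algebra.
From mathcomp Require Import all_classical all_reals all_analysis.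
From mathcomp Require Import measurable_realfun lra ring.
Import Order.TTheory GRing.Theory Num.Theory.
Local Open Scope classical_set_scope.
Local Open Scope ring_scope.

(** By the length property, a mistake at [x_t] has a boundary point within the
    distance to its nearest neighbour. So the mistakes made at distance at least
    [r] from the boundary are [r]-separated, and doubling bounds those at distance
    between [r] and [2r] by the covering number of the boundary at scale [r]:
    about [r^-(d+c1)], which summed over the scales [r], [2r], [4r], ... gives
    again [r^-(d+c1)]. With the radii [r_t = (t+1)^(-1/(d+1))], smoothness and
    the Minkowski content bound the probability that [x_t] is [r_t]-close to the
    boundary by a multiple of [r_t]. The slack [c1] makes the expectation of
    [sum_t 1{x_t is r_t-close} (t+1)^-a], [a = (d+c1)/(d+1)], finite, so a single
    use of Markov's inequality bounds the number of close points before time [T]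
    by a multiple of [T^a] for all [T] at once. *)

(** * Length spaces: paths that cross the boundary *)

Section LengthSpaces.
Context {R : realType} {X : Type} {rho : X -> X -> R}.
Hypothesis rho_metric : is_metric rho.

Lemma rho_ge0 (x y : X) : 0 <= rho x y.
Proof.
have [rxx _ rC tri] := rho_metric.
by have := tri x y x; rewrite rxx (rC y x); lra.
Qed.

Lemma locally_constant_off_cboundary {Y : eqType} {c : X -> Y} {x : X} :
  ~ cboundary rho c x ->
  exists2 e : R, 0 < e & forall x', rho x x' < e -> c x' = c x.
Proof.
move=> nbx; apply: contrapT => H; apply: nbx; rewrite /cboundary /margin /=.
apply/eqP; rewrite eq_le; apply/andP; split.
  apply/lee_addgt0Pr => e e0; rewrite add0e.
  have [x' [xx' cx']] : exists x', rho x x' < e /\ c x' <> c x.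
    apply: contrapT => H'; apply: H; exists e => // x' xx'.
    by apply: contrapT => cx'; apply: H'; exists x'.
  apply: (@le_trans _ _ (rho x x')%:E); last by rewrite lee_fin ltW.
  by apply: ereal_inf_lbound; exists x' => //=; apply/eqP.
by apply: le_ereal_inf_tmp => _ [x' _ <-]; rewrite lee_fin rho_ge0.
Qed.

(** Off the boundary the label is locally constant along [g], and [0,1] is connected: the supremum
    of the times up to which the label never changes is itself such a time, and could be pushed
    further unless it is 1. *)
Lemma path_meets_cboundary {Y : eqType} {c : X -> Y} {g : R -> X} :
  cont_path rho g -> c (g 0) != c (g 1) ->
  exists2 s : R, 0 <= s <= 1 & cboundary rho c (g s).
Proof.
move=> cg /eqP cg01; apply: contrapT => H.
have [_ _ rC _] := rho_metric.
have loc s : 0 <= s <= 1 -> exists2 del : R, 0 < del &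
    forall u, 0 <= u <= 1 -> `|u - s| < del -> c (g u) = c (g s).
  move=> s01; have [|e e0 he] := @locally_constant_off_cboundary _ c (g s).
    by move=> bs; apply: H; exists s.
  have [del del0 hdel] := cg s s01 e e0; exists del => // u u01 us.
  by apply: he; rewrite rC; exact: hdel.
pose S := [set s : R | 0 <= s <= 1 /\
  forall u, 0 <= u <= s -> c (g u) = c (g 0)].
have S0 : S 0.
  by split; [lra|] => u u0; congr (c (g _)); lra.
have ubS : ubound S 1 by move=> s [s01 _]; lra.
have hsS : has_sup S by split; [exists 0|exists 1].
have s0S : 0 <= sup S by apply: ub_le_sup => //; exists 1.
have S1 : sup S <= 1 by apply: ge_sup => //; exists 0.
have s01 : 0 <= sup S <= 1 by apply/andP.
have [del del0 hdel] := loc _ s01.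
have [s [s01' hs] ss] := sup_adherent del0 hsS.
have sS : s <= sup S by apply: ub_le_sup; [exists 1|split].
have csS : c (g (sup S)) = c (g 0).
  rewrite -(hs s); last by lra.
  by apply/esym/hdel => //; rewrite ltr_norml; lra.
pose u := Num.min 1 (sup S + del / 2).
have u1 : u <= 1 by rewrite /u ge_min lexx.
have uS : u <= sup S + del / 2 by rewrite /u ge_min lexx orbT.
have Su : S u.
  split; first by rewrite u1 andbT /u le_min; lra.
  move=> v /andP[v0 vu]; have [vs|vs] := leP v s; first by apply: hs; lra.
  by rewrite (hdel v) //; [lra|rewrite ltr_norml; lra].
have : u <= sup S by apply: ub_le_sup; [exists 1|].
rewrite /u; case: (leP 1 (sup S + del / 2)) => h1 h2.
  by apply: cg01; rewrite -csS; congr (c (g _)); lra.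
have : del <= 0 by lra.
by rewrite leNgt del0.
Qed.

Lemma rho_le_path_length (g : R -> X) (s : R) : 0 <= s <= 1 ->
  ((rho (g 0) (g s))%:E <= path_length rho g)%E.
Proof.
move=> s01; apply: ereal_sup_ubound; exists [:: 0; s] => /=.
  by split => /=; lra.
by rewrite /partition_sum /= big_ord_recl big_ord0 addr0.
Qed.

(** Strictness leaves room for a path of length below [r]; the point where it meets the boundary is
    no farther from [x] than that length. *)
Lemma near_cboundary {Y : eqType} {c : X -> Y} {x x' : X} {r : R} :
  length_space rho -> c x != c x' -> rho x x' < r ->
  expansion rho (cboundary rho c) r x.
Proof.
move=> ls cxx' xx'r; have [_ _ rC _] := rho_metric.
have : ((rho x x')%:E < r%:E)%E by rewrite lte_fin.
rewrite (ls x x') => /ereal_inf_lt[_ [g [cg [g0 g1]] <-]] lgr.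
have [|s s01 bs] := @path_meets_cboundary _ c g cg; first by rewrite g0 g1.
exists (g s) => //; rewrite /rball /= rC -g0 -lte_fin.
exact: le_lt_trans (rho_le_path_length g s s01) lgr.
Qed.

End LengthSpaces.

(** * Coverings, doubling and packing *)

Section Coverings.
Context {R : realType} {X : Type} {rho : X -> X -> R}.
Hypothesis rho_metric : is_metric rho.

(** The bound [K] is real, so that the doubling constant and powers of radii multiply into it
    directly. *)
Definition has_cover (r : R) (A : set X) (K : R) : Prop :=
  exists s : seq X, (size s)%:R <= K /\
    A `<=` \bigcup_(y in [set y | inseq y s]) rball rho y r.

Lemma inseq_cat (y : X) (s1 s2 : seq X) :
  inseq y (s1 ++ s2) <-> inseq y s1 \/ inseq y s2.
Proof. by elim: s1 => [|z s1 IH] /=; [|rewrite IH]; tauto. Qed.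

Lemma inseq_nth (x0 y : X) (s : seq X) :
  inseq y s -> exists2 i, (i < size s)%N & nth x0 s i = y.
Proof.
elim: s => //= z s IH [->|/IH[i si <-]]; first by exists 0%N.
by exists i.+1.
Qed.

Lemma has_cover_le (r r' : R) (A : set X) (K : R) :
  r <= r' -> has_cover r A K -> has_cover r' A K.
Proof.
move=> rr' [s [sK As]]; exists s; split=> // x /As[y ys yx].
by exists y => //; exact: lt_le_trans yx rr'.
Qed.

Lemma has_cover_half (D : R) (r : R) (A : set X) (K : R) : 0 <= D ->
  (forall x, has_cover (r / 2) (rball rho x r) D) ->
  has_cover r A K -> has_cover (r / 2) A (K * D).
Proof.
move=> D0 doubling [s [sK As]].
suff [s' [s'K ss']] : has_cover (r / 2)
    (\bigcup_(y in [set y | inseq y s]) rball rho y r) ((size s)%:R * D).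
  exists s'; split; last exact: subset_trans As ss'.
  by apply: le_trans s'K _; rewrite ler_wpM2r.
elim: s {As sK} => [|y s [s' [s'K s'S]]].
  by exists [::]; split=> [|x [] //]; rewrite mul0r.
have [s0 [s0D s0S]] := doubling y.
exists (s0 ++ s'); split.
  by rewrite size_cat natrD /= -[(size s).+1%:R]natr1; lra.
move=> x [z /= [<-|zs] xz].
  by have [u us ux] := s0S _ xz; exists u => //; apply/inseq_cat; left.
have [u us ux] := s'S x (ex_intro2 _ _ z zs xz).
by exists u => //; apply/inseq_cat; right.
Qed.

Lemma has_cover_iter (D : R) : 0 <= D ->
  (forall r x, 0 < r -> has_cover (r / 2) (rball rho x r) D) ->
  forall n r A K, 0 < r ->
  has_cover r A K -> has_cover (r / 2 ^+ n) A (K * D ^+ n).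
Proof.
move=> D0 doubling; elim=> [|n IH] r A K r0 rAK.
  by rewrite !expr0 divr1 mulr1.
have -> : r / 2 ^+ n.+1 = (r / 2 ^+ n) / 2.
  by rewrite exprSr invfM mulrA.
have -> : K * D ^+ n.+1 = K * D ^+ n * D by rewrite exprSr mulrA.
apply: has_cover_half => //; last exact: IH.
by move=> x; apply: doubling; rewrite divr_gt0 // exprn_gt0.
Qed.

Lemma has_cover_expansion (r t : R) (A : set X) (K : R) :
  has_cover r A K -> has_cover (r + t) (expansion rho A t) K.
Proof.
have [_ _ _ tri] := rho_metric.
move=> [s [sK As]]; exists s; split=> // x [z /As[y ys yz] zx].
exists y => //; rewrite /rball /= in yz zx *.
by have := tri y z x; lra.
Qed.

(** A nonempty space is one ball of radius [|B| + 1], halved until the radius is at most [e]. The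
    point of [X] serves as its centre, and [K] does not depend on it. *)
Lemma totally_bounded (D e : R) : 0 <= D -> 0 < e ->
  (forall r x, 0 < r -> has_cover (r / 2) (rball rho x r) D) ->
  bounded_space rho ->
  exists2 K : R, 0 <= K & X -> has_cover e setT K.
Proof.
move=> D0 e0 doubling [B hB].
have B0 : 0 < `|B| + 1 by apply: ltr_wpDl.
pose n := (Num.truncn ((`|B| + 1) / e)).+1.
exists (1 * D ^+ n); first by rewrite mul1r exprn_ge0.
move=> x0; apply: (@has_cover_le ((`|B| + 1) / 2 ^+ n)).
  rewrite ler_pdivrMr ?exprn_gt0// mulrC -ler_pdivrMr//.
  apply: ltW; apply: lt_trans (truncnS_gt _) _.
  by rewrite -natrX ltr_nat; exact: ltn_expl.
apply: has_cover_iter => //; exists [:: x0]; split=> // x _.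
exists x0 => /=; first by left.
by rewrite /rball /=; have := hB x0 x; have := ler_norm B; lra.
Qed.

(** Pigeonhole: points sharing a ball of radius [r / 2] are less than [r] apart, so choosing a
    centre for each index of [M] is injective. *)
Lemma card_separated {T : nat} {xs : nat -> X} {M : {set 'I_T}} {r : R}
    {A : set X} {K : R} :
  has_cover (r / 2) A K ->
  (forall i j : 'I_T, i \in M -> j \in M -> (i < j)%N ->
     r <= rho (xs j) (xs i)) ->
  (forall i : 'I_T, i \in M -> A (xs i)) ->
  #|M|%:R <= K.
Proof.
have [_ _ rC tri] := rho_metric.
move=> [s [sK As]] sep MA; apply: le_trans sK; rewrite ler_nat.
have [->|[i0 i0M]] := set_0Vmem M; first by rewrite cards0.
(* The additional index makes the default [ord0] available outside [M], whatever the size of [s];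
   [W] below restricts to genuine indices again. *)
have center (i : 'I_T) : exists k : 'I_(size s).+1, i \in M ->
    (k < size s)%N /\ rho (nth (xs i0) s k) (xs i) < r / 2.
  have [iM|] := boolP (i \in M); last by exists ord0.
  have [y /(inseq_nth (xs i0))[k ks <-] yi] := As _ (MA i iM).
  by exists (Ordinal (leqW ks)).
have {center} [f hf] := choice center.
have finj : {in M &, injective f}.
  move=> i j iM jM fij; apply/val_inj => /=.
  have [_ hi] := hf i iM; have [_ hj] := hf j jM; rewrite fij in hi.
  have ij : rho (xs i) (xs j) < r.
    have := tri (xs i) (nth (xs i0) s (f j)) (xs j).
    by rewrite (rC (xs i) (nth _ _ _)); lra.
  case: (ltngtP i j) => // lt.
    by have := sep _ _ iM jM lt; rewrite rC leNgt ij.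
  by have := sep _ _ jM iM lt; rewrite leNgt ij.
rewrite -(card_in_imset finj) -[X in (_ <= X)%N](card_ord (size s)).
pose W := [set k : 'I_(size s).+1 | (k < size s)%N]%SET.
apply: (@leq_trans #|W|).
  apply/subset_leq_card/fintype.subsetP => _ /imsetP[i iM ->].
  by rewrite inE; have [] := hf i iM.
have -> : W = (fun k : 'I_(size s) => widen_ord (leqnSn _) k) @: 'I_(size s).
  apply/setP => k; rewrite inE; apply/idP/imsetP => [ks|[k' _ ->]].
    by exists (Ordinal ks) => //; exact: val_inj.
  exact: (ltn_ord k').
exact: leq_imset_card.
Qed.

End Coverings.

Arguments has_cover {R X} rho r A K.

(** * Counting the mistakes far from the boundary *)

Section FarMistakes.
Context {R : realType} {X : Type} {rho : X -> X -> R} {Y : eqType} {c : X -> Y}.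
Hypotheses (rho_metric : is_metric rho) (rho_length : length_space rho).
Context {xs : nat -> X} {nn : nat -> nat}.
Hypothesis nnP : is_nn rho xs nn.
Let bd := cboundary rho c.

(** Round 0 is included to match [mistakes]. Balls are open, so lying outside the expansion means
    distance at least [r] from every boundary point. *)
Definition far_mistakes (T : nat) (r : R) : {set 'I_T} :=
  [set t : 'I_T | ((t == 0%N :> nat) || (c (xs (nn t)) != c (xs t))) &&
    `[< ~ expansion rho bd r (xs t) >]]%SET.

(** If an earlier point were closer than [r], so would be the nearest neighbour, whose label
    differs; a boundary point would then lie within [r]. *)
Lemma far_mistakes_separated (T : nat) (r : R) (i j : 'I_T) :
  j \in far_mistakes T r -> (i < j)%N -> r <= rho (xs j) (xs i).
Proof.
rewrite inE => /andP[/orP[/eqP->//|mj] /asboolP njr] ij.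
have [_ /(_ i ij)] := nnP j (leq_ltn_trans (leq0n i) ij).
apply: le_trans; rewrite leNgt; apply/negP => lt_r; apply: njr.
by apply: near_cboundary lt_r => //; rewrite eq_sym.
Qed.

(* The new far mistakes lie in the annulus between distance r and 2r from the
   boundary and are r-separated. *)
Lemma far_mistakes_double (D r N : R) (T : nat) : 0 <= D -> 0 < r ->
  (forall s x, 0 < s -> has_cover rho (s / 2) (rball rho x s) D) ->
  has_cover rho r bd N ->
  #|far_mistakes T r|%:R <= #|far_mistakes T (2 * r)|%:R + N * D ^+ 3.
Proof.
move=> D0 r0 doubling bdN.
pose M := [set t in far_mistakes T r | `[< expansion rho bd (2 * r) (xs t) >]]%SET.
have sub : far_mistakes T r \subset far_mistakes T (2 * r) :|: M.
  apply/fintype.subsetP => t tr; rewrite !inE.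
  have := tr; rewrite inE => /andP[-> ->]/=.
  by rewrite asbool_neg orNb.
have := leq_trans (subset_leq_card sub) (leq_card_setU _ _).
rewrite -(ler_nat R) natrD => /le_trans; apply.
rewrite lerD2l.
(* The centres of a cover of the boundary at radius [r] cover its [2r]-expansion at radius
   [3r <= 4r]; three halvings reach [r / 2], whence [D ^+ 3]. *)
have cov : has_cover rho (r / 2) (expansion rho bd (2 * r)) (N * D ^+ 3).
  have -> : r / 2 = 4 * r / 2 ^+ 3 by field.
  apply: has_cover_iter => //; first by lra.
  apply: (@has_cover_le _ _ _ (r + 2 * r)); first by lra.
  exact: has_cover_expansion.
apply: (card_separated rho_metric (xs := xs) cov).
  move=> i j _; rewrite inE => /andP[jr _] ij.
  exact: far_mistakes_separated jr ij.
by move=> i; rewrite inE => /andP[_ /asboolP].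
Qed.

(** Double [r] until it reaches [del], where the mistakes are [del]-separated and number at most
    [K0]. As [q >= 1], passing to [2r] at least halves [r^-q]: the inductive bound contributes
    [2 D^3 r^-q] and the annulus as much again, whence the 4. *)
Lemma far_mistakes_bound (D q del K0 : R) (T : nat) : 0 <= D -> 1 <= q -> 0 < del ->
  (forall s x, 0 < s -> has_cover rho (s / 2) (rball rho x s) D) ->
  (forall r, 0 < r < del -> has_cover rho r bd (2 * r `^ (- q))) ->
  has_cover rho (del / 2) setT K0 ->
  forall r, 0 < r ->
  #|far_mistakes T r|%:R <= K0 + 4 * D ^+ 3 * r `^ (- q).
Proof.
move=> D0 q1 del0 doubling bdN XK0 r r0.
have D3 : 0 <= D ^+ 3 by rewrite exprn_ge0.
have [n] : exists n, del <= r * 2 ^+ n.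
  exists (Num.truncn (del / r)).+1; rewrite mulrC -ler_pdivrMr//.
  apply: ltW; apply: lt_trans (truncnS_gt _) _.
  by rewrite -natrX ltr_nat; exact: ltn_expl.
elim: n r r0 => [|n IH] r r0 rn.
  rewrite expr0 mulr1 in rn.
  apply: (@le_trans _ _ K0); last first.
    by rewrite lerDl !mulr_ge0 ?powR_ge0.
  apply: (card_separated rho_metric (xs := xs) XK0) => // i j _ jr ij.
  exact: le_trans rn (far_mistakes_separated _ _ _ _ jr ij).
have [rdel|rdel] := leP del r.
  apply: IH => //; apply: le_trans rdel _.
  by rewrite ler_peMr ?(ltW r0)// exprn_ege1//; lra.
have rN := bdN r; rewrite r0 rdel in rN.
apply: le_trans (far_mistakes_double _ _ _ T D0 r0 doubling (rN erefl)) _.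
have r20 : 0 < 2 * r by lra.
have rn2 : del <= 2 * r * 2 ^+ n by rewrite -mulrA mulrCA -exprS.
have := IH _ r20 rn2; rewrite powRM ?(ltW r0)//.
have h2 : 2 `^ (- q) <= 2^-1 :> R.
  by rewrite -powR_inv1//; apply: ler_powR; lra.
have P0 := powR_ge0 r (- q).
set P := r `^ (- q) in P0 *; set H := 2 `^ (- q) in h2 *; set E := D ^+ 3 in D3 *.
have : E * (H * P) <= E * (2^-1 * P) by rewrite ler_wpM2l// ler_wpM2r.
by lra.
Qed.

End FarMistakes.

Arguments far_mistakes {R X} rho {Y} c xs nn T r.

(** * Box dimension and Minkowski content turned into bounds at each scale *)

Section Dimensions.
Context {R : realType} {X : Type} {rho : X -> X -> R}.

Lemma limsup0_lt (f : R -> \bar R) (a b : R) : limsup0 f = a%:E -> a < b ->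
  exists2 del : R, 0 < del <= 1 & forall r, 0 < r < del -> (f r <= b%:E)%E.
Proof.
move=> fa ab; have : (limsup0 f < b%:E)%E by rewrite fa lte_fin.
move=> /ereal_inf_lt[_ [del del01 <-]] /ltW/ereal_supP h.
by exists del => // r rdel; apply: h; exists r.
Qed.

Lemma covering_of_box_dim (A : set X) (d q : R) :
  box_dim rho A = d%:E -> d < q -> 0 <= q ->
  exists2 del : R, 0 < del <= 1 & forall r, 0 < r < del ->
    has_cover rho r A (2 * r `^ (- q)).
Proof.
move=> dA dq q0; have [del del01 h] := limsup0_lt _ _ _ dA dq.
exists del => // r rdel; have := h r rdel.
have r01 : 0 < r < 1 by lra.
have r0 : 0 < r by lra.
have ln0 : 0 < ln (1 / r) by rewrite ln_gt0// ltr_pdivlMr//; lra.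
have rq1 : 1 <= r `^ (- q).
  by rewrite powRN -(powRr0 r) -powRN; apply: ger_powR; lra.
have : (0 <= covnum rho r A)%E.
  by apply: le_ereal_inf_tmp => _ [n _ <-]; rewrite lee_fin.
case E : (covnum rho r A) => [a| |] //=.
- rewrite lee_fin => a0; rewrite -EFinM lee_fin ler_pdivrMr// => lnaq.
  have ar : a <= r `^ (- q).
    (* At [a = 0], as for an empty set, [ln] takes a default value and carries no information. *)
    have [->|an0] := eqVneq a 0; first exact: powR_ge0.
    have a_gt0 : 0 < a by rewrite lt0r an0.
    rewrite -ler_ln ?posrE ?powR_gt0//.
    by rewrite ln_powR; move: lnaq; rewrite div1r lnV ?posrE//; lra.
  (* A cover with fewer than [a + 1] centres exists; the factor 2 absorbs the 1, as [r^-q >= 1]. *)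
  have : (covnum rho r A < (a + 1)%:E)%E by rewrite E lte_fin; lra.
  move=> /ereal_inf_lt[_ [n [s [ssz As]] <-]]; rewrite lte_fin => na.
  by exists s; split=> //; rewrite ssz; lra.
(* An infinite covering number would make the quotient infinite, hence above [q]. *)
- by move=> _; rewrite gt0_mulye ?lte_fin ?invr_gt0.
Qed.

End Dimensions.

(** Below some [del] the content gives the slope [mm + 1]; from [del] on, [nu setT / del * r]
    already reaches the total mass. All radii are covered because those used later start at 1. *)
Lemma content_bound {R : realType} {dX : measure_display} {X : measurableType dX}
    {rho : X -> X -> R} (nu : {finite_measure set X -> \bar R}) (A : set X) (mm : R) :
  nu A = 0%E -> minkowski_content rho nu A = mm%:E ->
  (forall r, measurable (expansion rho A r)) ->
  0 <= mm /\ exists2 K : R, 0 < K &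
    forall r, 0 < r -> (nu (expansion rho A r) <= (K * r)%:E)%E.
Proof.
move=> nuA mA mexp.
have fn B : measurable B -> (fine (nu B))%:E = nu B.
  by move=> mB; rewrite fineK// fin_num_measure.
have f0 B : 0 <= fine (nu B) by rewrite fine_ge0.
split.
  rewrite -lee_fin -mA; apply: le_ereal_inf_tmp => _ [del /andP[del0 _] <-].
  apply: le_ereal_sup_tmp.
  exists ((fine (nu (expansion rho A (del / 2))) - fine (nu A)) / (del / 2))%:E.
    by exists (del / 2) => //=; lra.
  by rewrite nuA /= subr0 lee_fin divr_ge0//; lra.
have [del /andP[del0 _] h] := limsup0_lt _ _ (mm + 1) mA ltac:(lra).
exists (`|mm + 1| + fine (nu setT) / del + 1) => [|r r0].
  by apply: ltr_wpDl => //; rewrite addr_ge0// divr_ge0// ltW.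
rewrite -fn// lee_fin.
have D0 : 0 <= fine (nu setT) / del by rewrite divr_ge0// ltW.
have [rdel|rdel] := ltP r del.
  have := h r; rewrite r0 rdel => /(_ erefl).
  rewrite nuA /= subr0 lee_fin ler_pdivrMr// => /le_trans; apply.
  by rewrite ler_wpM2r ?(ltW r0)//; have := ler_norm (mm + 1); lra.
apply: (@le_trans _ _ (fine (nu setT))).
  by apply: fine_le; rewrite ?fin_num_measure//; apply: le_measure; rewrite ?inE.
apply: (@le_trans _ _ (fine (nu setT) / del * r)).
  by rewrite -mulrA ler_peMr// ler_pdivlMl// mulr1.
by rewrite ler_wpM2r ?(ltW r0)//; have := normr_ge0 (mm + 1); lra.
Qed.

(** A union of open balls is open, whatever [A] is. *)
Lemma measurable_expansion {R : realType} {dX : measure_display}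
    {X : measurableType dX} {rho : X -> X -> R} (A : set X) (r : R) :
  is_metric rho -> (@measurable dX X) = <<s rho_open rho >> ->
  measurable (expansion rho A r).
Proof.
move=> [_ _ _ tri] ->; apply: sub_sigma_algebra => x [z Az zx].
exists (r - rho z x); first by rewrite subr_gt0.
move=> y xy; exists z => //; rewrite /rball /= in zx xy *.
by have := tri z x y; lra.
Qed.

(** * A convergent series and Markov's inequality *)

Section Probability.
Context {R : realType}.

(* From [(1 + 1/t)^del >= 1 + del * ln (1 + 1/t) >= 1 + del / (t + 1)]. *)
Lemma powR_telescope (del t : R) : 0 < del -> 1 <= t ->
  del / (del + 2) * t `^ (- (1 + del)) <= t `^ (- del) - (t + 1) `^ (- del).
Proof.
move=> del0 t1; have t0 : 0 < t by lra.
have u0 : 0 < t / (t + 1) by rewrite divr_gt0//; lra.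
have lnu : ln (t / (t + 1)) <= - (t + 1)^-1.
  have -> : t / (t + 1) = 1 + - (t + 1)^-1 by field; lra.
  apply: le_ln1Dx; rewrite ltrN2 invf_lt1//; lra.
have -> : (t + 1) `^ (- del) = t `^ (- del) * (t / (t + 1)) `^ del.
  rewrite powRM ?invr_ge0; try lra.
  rewrite mulrA -powRD; last by rewrite addNr eqxx gt_eqF.
  rewrite addNr powRr0 mul1r -powR_inv1; last by lra.
  by rewrite -powRrM mulN1r.
have -> : t `^ (- (1 + del)) = t `^ (- del) * t^-1.
  rewrite -powR_inv1 ?(ltW t0)// -powRD; last by apply/implyP => _; rewrite gt_eqF.
  by congr (_ `^ _); lra.
have P0 := powR_ge0 t (- del).
suff : (t / (t + 1)) `^ del <= 1 - del / (del + 2) * t^-1.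
  move=> h; have := ler_wpM2l P0 h; lra.
rewrite /powR gt_eqF//.
have : expR (del * ln (t / (t + 1))) <= expR (- (del / (t + 1))).
  by rewrite ler_expR -mulrN ler_wpM2l// ltW.
move=> /le_trans; apply.
rewrite expRN.
have := expR_ge1Dx (del / (t + 1)).
set y := expR _ => hy.
have s0 : 0 < del / (t + 1) by rewrite divr_gt0//; lra.
apply: (@le_trans _ _ (1 + del / (t + 1))^-1).
  by rewrite lef_pV2 ?posrE//; lra.
have -> : (1 + del / (t + 1))^-1 = 1 - del / (t + 1 + del).
  by field; apply/andP; split; lra.
(* As [t >= 1], [t + 1 + del <= (del + 2) * t]; hence the constant [del / (del + 2)]. *)
rewrite lerB// -mulrA ler_wpM2l ?(ltW del0)// -invfM lef_pV2 ?posrE ?mulr_gt0//; nra.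
Qed.

Lemma sum_powR_bound (del : R) (n : nat) : 0 < del ->
  \sum_(0 <= t < n) t.+1%:R `^ (- (1 + del)) <= (del + 2) / del.
Proof.
move=> del0.
have c0 : 0 < del / (del + 2) by rewrite divr_gt0//; lra.
suff : del / (del + 2) * \sum_(0 <= t < n) t.+1%:R `^ (- (1 + del))
    <= 1 - n.+1%:R `^ (- del).
  rewrite -ler_pdivlMl// invf_div => /le_trans; apply.
  by rewrite ler_piMr ?gerBl ?powR_ge0// divr_ge0//; lra.
elim: n => [|n IH]; first by rewrite big_nil mulr0 powR1 subrr.
rewrite big_nat_recr //= mulrDr.
have := powR_telescope del n.+1%:R del0; rewrite ler1n => /(_ erefl).
by rewrite natr1; lra.
Qed.

Context {dO : measure_display} {O : measurableType dO} (P : probability O R).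

(* Markov's inequality applied to [sum_t w_t 1_(F t)]. *)
Lemma weighted_count_bound (F : nat -> set O) (w b : nat -> R) (S p : R) :
  0 < p -> 0 < S -> (forall t, measurable (F t)) -> (forall t, 0 <= w t) ->
  (forall t, (P (F t) <= (b t)%:E)%E) ->
  (forall n, \sum_(0 <= t < n) w t * b t <= S) ->
  exists E : set O, [/\ measurable E, ((1 - p)%:E <= P E)%E &
    forall o, E o -> forall n, \sum_(0 <= t < n) w t * \1_(F t) o <= S / p].
Proof.
move=> p0 S0 mF w0 hb hS.
pose f t o := ((w t * \1_(F t) o)%:E : \bar R).
have f0 t o : (0 <= f t o)%E by rewrite lee_fin mulr_ge0.
have mf t : measurable_fun setT (f t).
  apply/measurable_EFinP; apply: measurable_funM; first exact: measurable_cst.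
  exact: measurable_indic.
(* The full series dominates every partial sum, so one exceptional event serves all [n]. *)
pose Z o := (\sum_(0 <= t <oo) f t o)%E.
have Z0 o : (0 <= Z o)%E by apply: nneseries_ge0 => t _ _; exact: f0.
have mZ : measurable_fun setT Z.
  by apply: ge0_emeasurable_sum => t *.
have intZ : (\int[P]_o Z o <= S%:E)%E.
  rewrite integral_nneseries//.
  apply: lime_le.
    by apply: is_cvg_nneseries => t _ _; apply: integral_ge0.
  apply: nearW => n.
  apply: (@le_trans _ _ (\sum_(0 <= t < n) (w t * b t)%:E)%E); last first.
    by rewrite sumEFin lee_fin.
  apply: lee_sum => t _; rewrite /f.
  under eq_integral do rewrite EFinM.
  rewrite ge0_integralZl//.
  - rewrite integral_indic// setIT EFinM.
    by apply: lee_wpmul2l; [rewrite lee_fin|exact: hb].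
  - by apply/measurable_EFinP; exact: measurable_indic.
  - by rewrite lee_fin.
have a0 : 0 < S / p by rewrite divr_gt0.
pose B := [set o | ((S / p)%:E <= `|Z o|)%E].
have mB : measurable B.
  have mabsZ := measurableT_comp (@abse_measurable R setT) mZ.
  by have := emeasurable_fun_c_infty measurableT mabsZ (S / p)%:E; rewrite setTI.
have PB : (P B <= p%:E)%E.
  have : ((S / p)%:E * P B <= S%:E)%E.
    have := le_integral_abse P measurableT mZ a0; rewrite setTI => /le_trans; apply.
    by under eq_integral do rewrite gee0_abs//.
  rewrite -(fineK (fin_num_measure P B mB)) -EFinM !lee_fin => h.
  rewrite -(ler_pM2l a0); apply: le_trans h _.
  by rewrite divfK ?gt_eqF.
exists (~` B); split; first exact: measurableC.
  rewrite probability_setC//.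
  have := fineK (fin_num_measure P B mB) => hB; move: PB; rewrite -hB.
  by rewrite -EFinB !lee_fin; lra.
move=> o /negP; rewrite -ltNge gee0_abs// => Zo n; rewrite -lee_fin.
apply: (le_trans _ (ltW Zo)); rewrite -sumEFin.
by apply: nneseries_lim_ge => t *; exact: f0.
Qed.

End Probability.

(** * Smoothness, and the choice of radii and constants *)

Lemma smooth_marginal {R : realType} {dO dX : measure_display}
    {O : measurableType dO} {X : measurableType dX} {P : probability O R}
    {nu : set X -> \bar R} {sigma : R} {xs : nat -> O -> X} (t : nat) (A : set X) :
  smooth_adversary P nu sigma xs -> measurable A ->
  (P (xs t @^-1` A) <= (sigma^-1)%:E * nu A)%E.
Proof.
move=> smooth mA.
have pT : past_events xs t setT.
  rewrite -setC0 -setTD; apply: (@sigma_algebraCD _ setT).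
  exact: sigma_algebra0.
(* The whole space as past event turns the conditional bound into one on the law of [xs t]. *)
by have := smooth t A setT mA pT; rewrite setTI probability_setT mule1.
Qed.

Theorem theorem9 (R : realType) (dX : measure_display) (X : measurableType dX)
  (rho : X -> X -> R) (nu : {finite_measure set X -> \bar R})
  (Y : eqType) (c : X -> Y) (sigma d mm c1 c2 p : R) :
  is_metric rho ->
  (@measurable dX X) = <<s rho_open rho >> ->
  bounded_space rho ->
  length_space rho ->
  finite_doubling_dim rho ->
  nu (cboundary rho c) = 0%E ->
  0 < sigma ->
  box_dim rho (cboundary rho c) = d%:E ->
  minkowski_content rho nu (cboundary rho c) = mm%:E ->
  1 < d ->
  0 < c1 -> 0 < c2 -> 0 < p ->
  exists C0 C1 : R, 0 < C0 /\ 0 < C1 /\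
    forall (dO : measure_display) (O : measurableType dO) (P : probability O R)
      (xs : nat -> O -> X),
      (forall t, measurable_fun setT (xs t)) ->
      smooth_adversary P nu sigma xs ->
      forall nn : O -> nat -> nat,
        (forall w, is_nn rho (fun t => xs t w) (nn w)) ->
        exists E : set O, measurable E /\ ((1 - p)%:E <= P E)%E /\
          forall w, E w -> forall T : nat,
            (mistakes c (fun t => xs t w) (nn w) T)%:R
              <= C0 + C1 * (((mm + c2) * T%:R / sigma) `^ ((d + c1) / (d + 1))).
Proof.
move=> rho_metric meas bounded lspace [C C0 [Gam doubling]] nuA sigma0 dimA mmA d1
  c10 c20 p0.
pose D := C * 2 `^ Gam; pose q := d + c1; pose a := q / (d + 1).
have D0 : 0 <= D by rewrite mulr_ge0 ?powR_ge0 ?ltW.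
have dbl (s : R) x : 0 < s -> has_cover rho (s / 2) (rball rho x s) D.
  exact: doubling.
have dq : d < q by rewrite ltrDl.
have q1 : 1 <= q by lra.
have [del /andP[del0 _] bdN] := covering_of_box_dim _ _ q dimA dq ltac:(lra).
have [K0 K00 XK0] := totally_bounded D (del / 2) D0 ltac:(lra) dbl bounded.
have mexp r : measurable (expansion rho (cboundary rho c) r).
  exact: measurable_expansion.
have [mm0 [K K_gt0 nuK]] := content_bound _ _ _ nuA mmA mexp.
have d10 : 0 < d + 1 by lra.
(* Since [a + 1 / (d + 1) = 1 + e], the weights times the radii form a convergent series. *)
pose e := c1 / (d + 1).
have e0 : 0 < e by rewrite divr_gt0.
have a0 : 0 < a by rewrite divr_gt0//; lra.
pose S := K / sigma * ((e + 2) / e).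
have S0 : 0 < S by rewrite !mulr_gt0 ?invr_gt0//; lra.
have h0 : 0 < (mm + c2) / sigma by rewrite divr_gt0//; lra.
(* [S / p] pays for the close rounds, [4 * D ^+ 3] for the far mistakes. *)
pose G := S / p + 4 * D ^+ 3.
have G0 : 0 < G by rewrite ltr_wpDr ?divr_gt0// mulr_ge0// exprn_ge0.
(* The second constant divides out [((mm + c2) / sigma)^a], which is positive even when [mm = 0]
   because [c2 > 0]. The 1 keeps the first constant positive when [K0 = 0]. *)
exists (K0 + 1), (G / ((mm + c2) / sigma) `^ a).
split; [by lra|split; first by rewrite divr_gt0 ?powR_gt0].
move=> dO O P xs mxs smooth nn nnP.
pose rad (t : nat) : R := t.+1%:R `^ (- (d + 1)^-1).
have rad0 t : 0 < rad t by rewrite powR_gt0.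
pose F t := xs t @^-1` expansion rho (cboundary rho c) (rad t).
have mF t : measurable (F t) by rewrite -[F t]setTI; exact: mxs.
have PF t : (P (F t) <= (K / sigma * rad t)%:E)%E.
  apply: le_trans (smooth_marginal t _ smooth (mexp _)) _.
  have -> : K / sigma * rad t = sigma^-1 * (K * rad t) by ring.
  by rewrite [X in (_ <= X)%E]EFinM lee_pmul2l ?lte_fin ?invr_gt0// nuK.
have sumS n :
    \sum_(0 <= t < n) t.+1%:R `^ (- a) * (K / sigma * rad t) <= S.
  rewrite (eq_bigr (fun t => K / sigma * t.+1%:R `^ (- (1 + e)))).
    by rewrite -mulr_sumr ler_wpM2l ?sum_powR_bound// ltW// divr_gt0.
  move=> t _; rewrite mulrCA -powRD; last by apply/implyP.
  by congr (_ * _ `^ _); rewrite /a /e /q; field; rewrite gt_eqF.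
have [E [mE PE Ebound]] := weighted_count_bound P F (fun t => t.+1%:R `^ (- a))
  _ S p p0 S0 mF (fun t => powR_ge0 _ _) PF sumS.
exists E; split=> //; split=> // w Ew [|T].
  rewrite /mistakes big_ord0; apply: addr_ge0; first by lra.
  by rewrite mulr_ge0 ?powR_ge0// divr_ge0 ?powR_ge0// ltW.
have -> : (mm + c2) * T.+1%:R / sigma = (mm + c2) / sigma * T.+1%:R by ring.
rewrite [(_ * T.+1%:R) `^ _]powRM ?(ltW h0)// mulrA divfK ?gt_eqF ?powR_gt0//.
(* For [t <= T] the weight [t.+1^-a] is at least [T.+1^-a], so multiplying the weighted sum by
   [T.+1^a] bounds the plain count. *)
have near : \sum_(t < T.+1) \1_(F t) w <= T.+1%:R `^ a * (S / p).
  have := Ebound w Ew T.+1; rewrite big_mkord.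
  rewrite -(ler_pM2l (powR_gt0 a (ltr0Sn R T))) => /(le_trans _); apply.
  rewrite mulr_sumr; apply: ler_sum => t _.
  rewrite mulrA ler_peMl// powRN -ler_pdivrMr ?invr_gt0 ?powR_gt0// invrK mul1r.
  by apply: ge0_ler_powR; rewrite ?nnegrE ?(ltW a0)// ler_nat.
have far := far_mistakes_bound rho_metric lspace (nnP w) D q del K0 T.+1 D0 q1 del0 dbl
  bdN (XK0 (xs 0%N w)) (rad T) (rad0 T).
have radTq : rad T `^ (- q) = T.+1%:R `^ a.
  by rewrite -powRrM; congr (_ `^ _); rewrite /a; field; rewrite gt_eqF.
rewrite radTq in far.
(* Far refers to the smallest radius [rad T]. Radii decrease, so a mistake within [rad T] of the
   boundary at round [t] is also within [rad t], and [F t] counts it. *)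
have : (mistakes c (xs^~ w) (nn w) T.+1)%:R <=
    \sum_(t < T.+1) \1_(F t) w +
    #|far_mistakes rho c (xs^~ w) (nn w) T.+1 (rad T)|%:R :> R.
  rewrite /mistakes natr_sum -sum1_card natr_sum.
  rewrite [X in _ <= _ + X]big_mkcond -big_split /=.
  apply: ler_sum => t _; rewrite inE indicE.
  set m := (_ || _); case: m => /=; last by rewrite addr_ge0.
  case: asboolP => [nexp|/contrapT[z bz zt]]; first by rewrite lerDr.
  rewrite addr0 mem_set//; exists z => //; apply: lt_le_trans zt _.
  rewrite /rad !powRN lef_pV2 ?posrE ?powR_gt0//.
  by apply: ge0_ler_powR; rewrite ?nnegrE ?invr_ge0 ?(ltW d10)// ler_nat.
have := powR_ge0 (T.+1%:R : R) a; rewrite /G.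
by move: near far; set B := _ `^ a; lra.
Qed.
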